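(* Fix integers $\Delta>\delta>0$ and write $c=\delta/\Delta$. Let $\alpha\in\mathbb{R}$ and let $G$ be a graph with minimum degree at least $\delta$ and maximum degree at most $\Delta$. Then: (1) if $\alpha\leq\log_c\bigl(\frac{1+c}{2c}\bigr)$, then $R_\alpha(G)\geq\frac{\Delta^{1+2\alpha}}{2}|G|$, with equality if $G$ is $\Delta$-regular; (2) if $\log_c\bigl(\frac{1+c}{2c}\bigr)\leq\alpha\leq \log_c\bigl(\frac2{1+c}\bigr)$, then $R_\alpha(G)\geq \frac{(\delta\Delta)^{1+\alpha}}{\delta+\Delta}|G|$, with equality if $G$ is $(\delta,\Delta)$-biregular; (3) if $\log_c\bigl(\frac2{1+c}\bigr)\leq \alpha$, then $R_\alpha(G)\geq \frac{\delta^{1+2\alpha}}{2}|G|$, with equality if $G$ is $\delta$-regular. These are the only graphs for which equality occurs, unless $\alpha$ lies on the boundary between two regimes, in which case both equality cases apply (and only those). Additionally, if $\alpha<-1/2$ then $R_\alpha(G)\leq \frac{\delta^{1+2\alpha}}{2}|G|$, with equality if and only if $G$ is $\delta$-regular; and if $\alpha>-1/2$ then $R_\alpha(G)\leq \frac{\Delta^{1+2\alpha}}{2}|G|$, with equality if and only if $G$ is $\Delta$-regular.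
   Context: Graphs are finite and simple; $|G|$ is the number of vertices and $d(u)$ the degree of vertex $u$. The generalised Randi\'c index with exponent $\alpha\in\mathbb{R}$ is $R_\alpha(G)=\sum_{uv\in E(G)}(d(u)d(v))^{\alpha}$. For integers $r,s\geq 1$, a graph is $(r,s)$-biregular if every vertex has degree $r$ or $s$ and every edge has one endpoint of each of these degrees.
   Formalization: At a boundary exponent, ''only those'' is corrected: equality holds iff every edge is of one of the two extremal types, possibly both in one graph; as stated it fails, e.g. for the path on 4 vertices with δ=1, Δ=2, 2^α=2/3. *)

(* Defs.v *)
From mathcomp Require Import all_boot all_order all_algebra.
From mathcomp Require Import reals exp.

Set Implicit Arguments.
Unset Strict Implicit.
Unset Printing Implicit Defensive.

Import Order.TTheory GRing.Theory Num.Theory.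
Local Open Scope ring_scope.

Record sgraph := SGraph {
  vertex :> finType;
  adj : rel vertex;
  adj_sym : symmetric adj;
  adj_irrefl : irreflexive adj }.

(* An edge is the two-element set of its endpoints. *)
Definition edges (G : sgraph) : {set {set G}} :=
  [set [set p.1; p.2] | p : G * G & adj p.1 p.2].

Definition deg (G : sgraph) (u : G) : nat := #|[set v | adj u v]|.

Definition randic (R : realType) (alpha : R) (G : sgraph) : R :=
  \sum_(A in edges G) (\prod_(u in A) (deg u)%:R) `^ alpha.

Definition regular (r : nat) (G : sgraph) : Prop := forall u : G, deg u = r.

Definition edge_type (r s : nat) (G : sgraph) (u v : G) : Prop :=
  (deg u = r /\ deg v = s) \/ (deg u = s /\ deg v = r).

Definition biregular (r s : nat) (G : sgraph) : Prop :=
  (forall u : G, deg u = r \/ deg u = s) /\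
  (forall u v : G, adj u v -> edge_type r s u v).

(* The edges of an r-regular graph all have type (r, r) and those of an
   (r, s)-biregular graph all have type (r, s); here both types may occur in
   the same graph.  For instance the path on four vertices is mixed 2 1 but
   neither 2-regular nor (2, 1)-biregular. *)
Definition mixed (r s : nat) (G : sgraph) : Prop :=
  (forall u : G, deg u = r \/ deg u = s) /\
  (forall u v : G, adj u v -> edge_type r r u v \/ edge_type r s u v).

Definition logb (R : realType) (c x : R) : R := ln x / ln c.

(* Main.v *)
(* Since a graph without isolated vertices satisfies
   |G| = \sum_(uv in E) (1 / d u + 1 / d v), the index is a weighted average of
   f (x, y) = (x y)^(1 + alpha) / (x + y): each edge contributes
   (d u d v)^alpha = (1 / d u + 1 / d v) * f (d u, d v).  In each variable f is
   strictly larger inside an interval than at the worse of its two ends, so on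
   [delta, Delta]^2 its minimum is attained at corners only; the corners are
   compared through c^alpha.  The upper bounds come from AM-GM, which gives
   f (x, y) <= (x y)^(1/2 + alpha) / 2. *)

Require Import Defs.
From mathcomp Require Import all_boot all_order all_algebra.
From mathcomp Require Import reals exp.
From mathcomp Require Import sequences ring lra.

Import Order.TTheory GRing.Theory Num.Theory.
Local Open Scope ring_scope.

(** * Edges as vertex pairs, and sums over them *)

Lemma adj_neq {G : sgraph} {u v : G} : adj u v -> u != v.
Proof. by apply: contraTneq => ->; rewrite adj_irrefl. Qed.

Lemma edgesP (G : sgraph) (A : {set G}) :
  reflect (exists u v : G, adj u v /\ A = [set u; v]) (A \in edges G).
Proof.
apply: (iffP imsetP) => [[[u v]]|[u [v [uv ->]]]]; last first.
  by exists (u, v); rewrite ?inE.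
by rewrite inE /= => uv ->; exists u, v.
Qed.

(** The map [v |-> [set u; v]] is injective on the neighbours of [u], since [u] is not its own
    neighbour, and its image is the set of edges through [u]. *)
Lemma card_edges_at (G : sgraph) (u : G) :
  #|[set A in edges G | u \in A]| = deg u.
Proof.
rewrite /deg -(card_in_imset (f := fun v => [set u; v])); last first.
  move=> v w; rewrite !inE => uv uw /setP/(_ v).
  by rewrite !inE eqxx orbT eq_sym (negPf (adj_neq uv)) => /esym/eqP.
congr #|pred_of_set _|; apply/setP => A; rewrite inE; apply/andP/imsetP.
  case=> /edgesP[v [w [vw ->]]]; rewrite !inE => /orP[]/eqP eu; subst u.
    by exists w; rewrite ?inE.
  by exists v; rewrite 1?setUC // inE adj_sym.
case=> v; rewrite inE => uv ->; split; last by rewrite !inE eqxx.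
by apply/edgesP; exists u, v.
Qed.

(** Double counting: [u] lies on [deg u] edges and receives [1 / deg u] from each, hence 1 in
    total. *)
Lemma sum_edges_inv_deg (R : realType) (G : sgraph) :
  (forall u : G, (0 < deg u)%N) ->
  \sum_(A in edges G) \sum_(u in A) (deg u)%:R^-1 = #|{: G}|%:R :> R.
Proof.
move=> deg_gt0; rewrite (exchange_big_dep predT) //=.
rewrite -sum1_card natr_sum; apply: eq_bigr => u _.
rewrite sumr_const -[X in _ *+ X](eq_card (A := [set A in edges G | u \in A])).
  by rewrite card_edges_at -(mulr_natr _^-1) mulVf // pnatr_eq0 -lt0n.
by move=> A; rewrite !inE.
Qed.

Lemma big_edge (T : Type) (idx : T) (op : Monoid.com_law idx) (G : sgraph)
    (u v : G) (F : G -> T) :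
  adj u v -> \big[op/idx]_(w in [set u; v]) F w = op (F u) (F v).
Proof. by move=> uv; rewrite big_setU1 ?big_set1 // inE adj_neq. Qed.

(** Under a termwise inequality, equal sums force equal terms. Phrasing this by adjacent pairs lets
    later arguments work with degrees of endpoints rather than with sets. *)
Lemma ler_sum_edges (R : realType) (G : sgraph) (E1 E2 : {set G} -> R) :
  (forall u v : G, adj u v -> E1 [set u; v] <= E2 [set u; v]) ->
  \sum_(A in edges G) E1 A <= \sum_(A in edges G) E2 A /\
  (\sum_(A in edges G) E1 A = \sum_(A in edges G) E2 A <->
   forall u v : G, adj u v -> E1 [set u; v] = E2 [set u; v]).
Proof.
move=> leE.
have [le_sum eq_sum] : \sum_(A in edges G) E1 A <= \sum_(A in edges G) E2 A
    ?= iff [forall (A | A \in edges G), E1 A == E2 A].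
  apply: leif_sum => A /edgesP[u [v [uv ->]]].
  by split=> //; exact: leE.
split=> //; split => [/eqP|eqE].
  rewrite eq_sum => /forall_inP eqE u v uv; apply/eqP/eqE.
  by apply/edgesP; exists u, v.
apply/eqP; rewrite eq_sum; apply/forall_inP => A /edgesP[u [v [uv ->]]].
by rewrite eqE.
Qed.

(** * The index as a weighted sum of edge ratios *)

(** The function [f] of the opening comment, on real arguments so that concavity in one variable can
    be used. *)
Definition edge_ratio {R : realType} (alpha x y : R) : R :=
  (x * y) `^ (1 + alpha) / (x + y).

Lemma edge_ratioC (R : realType) (alpha x y : R) :
  edge_ratio alpha x y = edge_ratio alpha y x.
Proof. by rewrite /edge_ratio (mulrC x) (addrC x). Qed.

Lemma powRM_edge_ratio (R : realType) (alpha x y : R) :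
  0 < x -> 0 < y -> (x * y) `^ alpha = (x^-1 + y^-1) * edge_ratio alpha x y.
Proof.
move=> x0 y0; rewrite /edge_ratio powRD; last first.
  by rewrite implybE mulf_neq0 ?orbT ?gt_eqF.
rewrite powRr1; last by rewrite mulr_ge0 // ltW.
by field; rewrite !gt_eqF //= addr_gt0.
Qed.

Lemma randic_edge_term (R : realType) (alpha : R) (G : sgraph) (u v : G) :
  (forall u : G, (0 < deg u)%N) -> adj u v ->
  (\prod_(w in [set u; v]) (deg w)%:R) `^ alpha =
  (\sum_(w in [set u; v]) (deg w)%:R^-1) *
  edge_ratio alpha (deg u)%:R (deg v)%:R.
Proof.
by move=> d0 uv; rewrite !big_edge //= powRM_edge_ratio // ltr0n.
Qed.

Lemma edge_weight_gt0 (R : realType) (G : sgraph) (u v : G) :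
  (forall u : G, (0 < deg u)%N) -> adj u v ->
  0 < \sum_(w in [set u; v]) (deg w)%:R^-1 :> R.
Proof.
by move=> d0 uv; rewrite big_edge //= ?addr_gt0 ?invr_gt0 ?ltr0n.
Qed.

(** Both sides are sums over edges with the same positive weights [1 / deg u + 1 / deg v], so the
    bound and its equality case can be checked edge by edge. *)
Lemma randic_ge (R : realType) (alpha K : R) (G : sgraph) :
  (forall u : G, (0 < deg u)%N) ->
  (forall u v : G, adj u v -> K <= edge_ratio alpha (deg u)%:R (deg v)%:R) ->
  K * #|{: G}|%:R <= randic alpha G /\
  (randic alpha G = K * #|{: G}|%:R <->
   forall u v : G, adj u v -> edge_ratio alpha (deg u)%:R (deg v)%:R = K).
Proof.
move=> d0 leK; rewrite -(sum_edges_inv_deg R) // mulr_sumr.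
have w0 u v := @edge_weight_gt0 R G u v d0.
pose E1 (A : {set G}) : R := K * \sum_(w in A) (deg w)%:R^-1.
pose E2 (A : {set G}) : R := (\prod_(w in A) (deg w)%:R) `^ alpha.
have [|le_sum eq_sum] := @ler_sum_edges R G E1 E2.
  move=> u v uv; rewrite /E1 /E2 randic_edge_term // mulrC ler_pM2l ?w0 //.
  exact: leK.
split=> //; split => [/esym/eq_sum eqE u v uv|eqE].
  have := eqE u v uv; rewrite /E1 /E2 randic_edge_term // mulrC => /mulfI -> //.
  by rewrite gt_eqF ?w0.
by apply/esym/eq_sum => u v uv; rewrite /E1 /E2 randic_edge_term // mulrC eqE.
Qed.

Lemma randic_le (R : realType) (alpha K : R) (G : sgraph) :
  (forall u : G, (0 < deg u)%N) ->
  (forall u v : G, adj u v -> edge_ratio alpha (deg u)%:R (deg v)%:R <= K) ->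
  randic alpha G <= K * #|{: G}|%:R /\
  (randic alpha G = K * #|{: G}|%:R <->
   forall u v : G, adj u v -> edge_ratio alpha (deg u)%:R (deg v)%:R = K).
Proof.
move=> d0 leK; rewrite -(sum_edges_inv_deg R) // mulr_sumr.
have w0 u v := @edge_weight_gt0 R G u v d0.
pose E1 (A : {set G}) : R := (\prod_(w in A) (deg w)%:R) `^ alpha.
pose E2 (A : {set G}) : R := K * \sum_(w in A) (deg w)%:R^-1.
have [|le_sum eq_sum] := @ler_sum_edges R G E1 E2.
  move=> u v uv; rewrite /E1 /E2 randic_edge_term // mulrC ler_pM2r ?w0 //.
  exact: leK.
split=> //; split => [/eq_sum eqE u v uv|eqE].
  have := eqE u v uv; rewrite /E1 /E2 randic_edge_term // mulrC => /mulIf -> //.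
  by rewrite gt_eqF ?w0.
by apply/eq_sum => u v uv; rewrite /E1 /E2 randic_edge_term // mulrC eqE.
Qed.

(** * The minimum on a square lies at its corners *)

Lemma powR_lt_tangent (R : realType) (b t : R) :
  0 < b -> b < 1 -> 0 < t -> t != 1 -> t `^ b < 1 + b * (t - 1).
Proof.
move=> b0 b1 t0 t1; have tE : t = expR (ln t) by rewrite lnK.
have := t1; rewrite -ln_eq0 // /powR (gt_eqF t0).
move: (ln t) tE => z -> z0.
have e0 := expR_gt0 (b * z).
have h1 : expR (b * z) * (1 + (1 - b) * z) < expR z.
  have -> : expR z = expR (b * z) * expR ((1 - b) * z).
    by rewrite -expRD; congr expR; ring.
  by rewrite ltr_pM2l // expR_gt1Dx // mulf_neq0 // subr_eq0 gt_eqF.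
have h2 : expR (b * z) * (1 + - (b * z)) < 1.
  rewrite -[ltRHS](expR0 R) -(subrr (b * z)) expRD ltr_pM2l //.
  by rewrite expR_gt1Dx // oppr_eq0 mulf_neq0 // gt_eqF.
have h3 : b * (expR (b * z) * (1 + (1 - b) * z)) < b * expR z.
  by rewrite ltr_pM2l.
have h4 : (1 - b) * (expR (b * z) * (1 + - (b * z))) < (1 - b) * 1.
  by rewrite ltr_pM2l // subr_gt0.
have -> : expR (b * z) = b * (expR (b * z) * (1 + (1 - b) * z)) +
   (1 - b) * (expR (b * z) * (1 + - (b * z))) by ring.
lra.
Qed.

Lemma edge_ratio_gt_ends {R : realType} {alpha K a b x y : R} :
  0 < a -> a < x -> x < b -> 0 < y ->
  K <= edge_ratio alpha a y -> K <= edge_ratio alpha b y ->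
  K < edge_ratio alpha x y.
Proof.
move=> a0 ax xb y0; have x0 := lt_trans a0 ax; have b0 := lt_trans x0 xb.
rewrite /edge_ratio !ler_pdivlMr ?ltr_pdivlMr ?addr_gt0 //.
set e := 1 + alpha; have h0 : 0 < (x * y) `^ e by rewrite powR_gt0 ?mulr_gt0.
(* Normalising at [x] turns the end values into powers of [a / x < 1] and [b / x > 1]. *)
have hE t : 0 < t -> (t * y) `^ e = (x * y) `^ e * (t / x) `^ e.
  move=> t0; rewrite -powRM ?mulr_ge0 ?invr_ge0 ?ltW //.
  by congr (_ `^ _); field; rewrite gt_eqF.
rewrite (hE a) // (hE b) //; move: h0; set h := (x * y) `^ e => h0 Ka Kb.
have [K0|K0] := lerP K 0.
  by apply: le_lt_trans h0; rewrite mulr_le0_ge0 // ltW // addr_gt0.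
(* For [e <= 0] the power is nonincreasing while the affine side increases, so the end [b]
   suffices. *)
have [e_le0|e_gt0] := lerP e 0.
  apply: (@lt_le_trans _ _ (K * (b + y))); first by rewrite ltr_pM2l // ltrD2r.
  apply: le_trans Kb _; rewrite ger_pMr // -(powRr0 (b / x)).
  by apply: ler_powR e_le0; rewrite ler_pdivlMr // mul1r ltW.
(* For [e >= 1] the end [a] suffices: the power drops at least by the factor [a / x], whereas
   [(a + y) / (x + y) > a / x]. Only [0 < e < 1] uses both ends, through the tangent at [x]. *)
have [e_lt1|e_ge1] := ltrP e 1; last first.
  have : (a / x) `^ e <= a / x.
    by apply: ge1r_powR e_ge1; rewrite divr_gt0 //= ler_pdivrMr // mul1r ltW.
  rewrite -(ler_pM2l h0) => /(le_trans Ka).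
  rewrite mulrA ler_pdivlMr // => Kax.
  rewrite -(ltr_pM2r a0); apply: lt_le_trans Kax.
  rewrite -!mulrA ltr_pM2l //.
  have : y * a < y * x by rewrite ltr_pM2l.
  lra.
have tangent t : 0 < t -> t != x -> h * (t / x) `^ e < h * (1 + e * (t / x - 1)).
  move=> t0 tx; rewrite ltr_pM2l //; apply: powR_lt_tangent => //.
    exact: divr_gt0.
  by apply: contra_neq tx => tx; rewrite -[LHS](divfK (lt0r_neq0 x0)) tx mul1r.
(* [x] is a convex combination of [a] and [b], and [t |-> K * (t + y)] is
   affine. *)
have Ta := le_lt_trans Ka (tangent a a0 (negbT (lt_eqF ax))).
have Tb := le_lt_trans Kb (tangent b b0 (negbT (gt_eqF xb))).
have ba : 0 < b - a by rewrite subr_gt0 (lt_trans ax).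
rewrite -(ltr_pM2l ba).
have -> : (b - a) * (K * (x + y)) =
    (b - x) * (K * (a + y)) + (x - a) * (K * (b + y)) by ring.
have -> : (b - a) * h = (b - x) * (h * (1 + e * (a / x - 1))) +
    (x - a) * (h * (1 + e * (b / x - 1))) by field; rewrite gt_eqF.
by apply: ltrD; rewrite ltr_pM2l ?subr_gt0.
Qed.

Lemma edge_ratio_ge_ends {R : realType} {alpha K a b x y : R} :
  0 < a -> a <= x <= b -> 0 < y ->
  K <= edge_ratio alpha a y -> K <= edge_ratio alpha b y ->
  K <= edge_ratio alpha x y /\
  (edge_ratio alpha x y = K -> x = a \/ x = b).
Proof.
move=> a0 /andP[ax xb] y0 Ka Kb.
have [->|/eqP xa] := x =P a; first by split=> // _; left.
have [->|/eqP xb'] := x =P b; first by split=> // _; right.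
have Kx : K < edge_ratio alpha x y.
  by apply: (edge_ratio_gt_ends a0) Ka Kb; rewrite // lt_neqAle ?xb' // eq_sym xa.
by split=> [|eK]; [exact: ltW | move: Kx; rewrite eK ltxx].
Qed.

(** The one-variable result is used twice: from the corners to the sides of the square, then from
    opposite sides to the interior. Running the last step in either variable gives the equality case
    for that variable. *)
Lemma edge_ratio_ge_corners {R : realType} {alpha K a b x y : R} :
  0 < a -> a <= x <= b -> a <= y <= b ->
  K <= edge_ratio alpha a a -> K <= edge_ratio alpha a b ->
  K <= edge_ratio alpha b b ->
  K <= edge_ratio alpha x y /\
  (edge_ratio alpha x y = K -> (x = a \/ x = b) /\ (y = a \/ y = b)).
Proof.
move=> a0 xab yab Kaa Kab Kbb.
have side z : a <= z <= b ->
    K <= edge_ratio alpha a z /\ K <= edge_ratio alpha b z.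
  move=> zab; have b0 : 0 < b.
    by case/andP: zab => az zb; apply: lt_le_trans (le_trans az zb).
  split; rewrite edge_ratioC.
    by apply: (proj1 (edge_ratio_ge_ends a0 zab a0 _ _)); rewrite // edge_ratioC.
  by apply: (proj1 (edge_ratio_ge_ends a0 zab b0 _ _)).
have pos z : a <= z <= b -> 0 < z by case/andP=> az _; apply: lt_le_trans az.
have [Kay Kby] := side y yab; have [Kax Kbx] := side x xab.
have [Kxy eqx] := edge_ratio_ge_ends a0 xab (pos y yab) Kay Kby.
have [_ eqy] := edge_ratio_ge_ends a0 yab (pos x xab) Kax Kbx.
by split=> // eK; split; [apply: eqx | apply: eqy; rewrite edge_ratioC].
Qed.

(** * Diagonal values and upper bounds by AM-GM *)

Lemma gt0_powRD (R : realType) (x r s : R) :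
  0 < x -> x `^ (r + s) = x `^ r * x `^ s.
Proof. by move=> x0; rewrite powRD // (gt_eqF x0) implybT. Qed.

Lemma edge_ratio_diag (R : realType) (alpha x : R) :
  0 < x -> edge_ratio alpha x x = x `^ (1 + 2 * alpha) / 2.
Proof.
move=> x0; rewrite /edge_ratio powRM ?ltW // -gt0_powRD //.
have -> : 1 + alpha + (1 + alpha) = (1 + 2 * alpha) + 1 by ring.
rewrite [x `^ (_ + 1)]gt0_powRD // powRr1 ?ltW //.
by field; rewrite gt_eqF // addr_gt0.
Qed.

(* AM-GM: [2 sqrt (x y) <= x + y]. *)
Lemma edge_ratio_le_GM {R : realType} (alpha : R) {x y : R} : 0 < x -> 0 < y ->
  edge_ratio alpha x y <= (x * y) `^ (1 / 2 + alpha) / 2.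
Proof.
move=> x0 y0; have xy0 := mulr_gt0 x0 y0; rewrite /edge_ratio.
have -> : 1 + alpha = 1 / 2 + alpha + 2^-1 by field.
rewrite [_ `^ (_ + 2^-1)]gt0_powRD // -mulrA ler_pM2l ?powR_gt0 //.
rewrite powR12_sqrt ?(ltW xy0) // ler_pdivrMr ?addr_gt0 // ler_pdivlMl //.
have s0 := sqrtr_ge0 (x * y); have s2 := sqr_sqrtr (ltW xy0).
move: s0 s2; set s := Num.sqrt _ => s0 s2; have := sqr_ge0 (x - y); nra.
Qed.

Lemma edge_ratio_diag_GM (R : realType) (alpha x : R) : 0 < x ->
  edge_ratio alpha x x = (x * x) `^ (1 / 2 + alpha) / 2.
Proof.
move=> x0; rewrite edge_ratio_diag // powRM ?ltW // -gt0_powRD //.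
by congr (_ `^ _ / 2); field.
Qed.

(** The exponent [1 / 2 + alpha] is negative, so the geometric-mean bound decreases strictly in
    [x * y >= a * a]; it is exact on the diagonal. *)
Lemma edge_ratio_le_min {R : realType} {alpha a x y : R} :
  alpha < - (1 / 2) -> 0 < a -> a <= x -> a <= y ->
  edge_ratio alpha x y <= edge_ratio alpha a a /\
  (edge_ratio alpha x y = edge_ratio alpha a a -> x = a /\ y = a).
Proof.
move=> alt a0 ax ay.
have x0 := lt_le_trans a0 ax; have y0 := lt_le_trans a0 ay.
have e0 : 0 < - (1 / 2 + alpha) by lra.
have GM := edge_ratio_le_GM alpha x0 y0.
have [[-> ->]|lt_aa] : (x = a /\ y = a) \/ a * a < x * y.
- have [->|/eqP xa] := x =P a; last first.
    right; apply: (@lt_le_trans _ _ (x * a)); last by rewrite ler_pM2l.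
    by rewrite ltr_pM2r // lt_neqAle eq_sym xa.
  have [->|/eqP ya] := y =P a; first by left.
  by right; rewrite ltr_pM2l // lt_neqAle eq_sym ya.
- by split.
- suff lt : edge_ratio alpha x y < edge_ratio alpha a a.
    by split; [exact: ltW | move=> e; move: lt; rewrite e ltxx].
  apply: le_lt_trans GM _; rewrite edge_ratio_diag_GM // ltr_pM2r ?invr_gt0 //.
  have [r r0 ->] : exists2 r : R, 0 < r & 1 / 2 + alpha = - r.
    by exists (- (1 / 2 + alpha)); rewrite ?opprK.
  rewrite !powRN ltf_pV2 ?posrE ?powR_gt0 ?mulr_gt0 //.
  by apply: gt0_ltr_powR; rewrite ?nnegrE ?mulr_ge0 ?ltW.
Qed.

(** Here the exponent [1 / 2 + alpha] is positive, so the geometric-mean bound increases strictly in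
    [x * y <= b * b]. *)
Lemma edge_ratio_le_max {R : realType} {alpha b x y : R} :
  - (1 / 2) < alpha -> 0 < x -> 0 < y -> x <= b -> y <= b ->
  edge_ratio alpha x y <= edge_ratio alpha b b /\
  (edge_ratio alpha x y = edge_ratio alpha b b -> x = b /\ y = b).
Proof.
move=> agt x0 y0 xb yb; have b0 := lt_le_trans x0 xb.
have e0 : 0 < 1 / 2 + alpha by lra.
have GM := edge_ratio_le_GM alpha x0 y0.
have [[-> ->]|lt_bb] : (x = b /\ y = b) \/ x * y < b * b.
- have [->|/eqP xb'] := x =P b; last first.
    right; apply: (@le_lt_trans _ _ (x * b)); first by rewrite ler_pM2l.
    by rewrite ltr_pM2r // lt_neqAle xb'.
  have [->|/eqP yb'] := y =P b; first by left.
  by right; rewrite ltr_pM2l // lt_neqAle yb'.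
- by split.
- suff lt : edge_ratio alpha x y < edge_ratio alpha b b.
    by split; [exact: ltW | move=> e; move: lt; rewrite e ltxx].
  apply: le_lt_trans GM _; rewrite edge_ratio_diag_GM // ltr_pM2r ?invr_gt0 //.
  by apply: gt0_ltr_powR; rewrite ?nnegrE ?mulr_ge0 ?ltW.
Qed.

(** * Comparing corners through logarithmic thresholds *)

(** A base below 1 has [ln c < 0], so clearing the denominator reverses the inequality. *)
Lemma ler_logb (R : realType) (c alpha x : R) :
  0 < c < 1 -> 0 < x -> (alpha <= logb c x) = (x <= c `^ alpha).
Proof.
move=> /andP[c0 c1] x0; have lc : ln c < 0 by apply: ln_lt0; rewrite c0.
by rewrite /logb ler_ndivlMr // -ln_powR ler_ln // posrE powR_gt0.
Qed.

Lemma ger_logb (R : realType) (c alpha x : R) :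
  0 < c < 1 -> 0 < x -> (logb c x <= alpha) = (c `^ alpha <= x).
Proof.
move=> /andP[c0 c1] x0; have lc : ln c < 0 by apply: ln_lt0; rewrite c0.
by rewrite /logb ler_ndivrMr // -ln_powR ler_ln // posrE powR_gt0.
Qed.

Lemma edge_ratio_corner_max {R : realType} (alpha : R) {a b : R} :
  0 < a -> 0 < b ->
  edge_ratio alpha a b =
  edge_ratio alpha b b * ((a / b) `^ alpha / ((1 + a / b) / (2 * (a / b)))).
Proof.
move=> a0 b0; rewrite /edge_ratio.
have -> : a * b = a / b * (b * b) by field; rewrite gt_eqF.
rewrite [in LHS]powRM ?divr_ge0 ?mulr_ge0 ?(ltW a0) ?(ltW b0) //.
rewrite [(a / b) `^ _]gt0_powRD ?divr_gt0 // powRr1 ?divr_ge0 ?ltW //.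
by field; rewrite !gt_eqF ?addr_gt0.
Qed.

(** The same for the other pair of adjacent corners, which yields the upper threshold. *)
Lemma edge_ratio_corner_min {R : realType} (alpha : R) {a b : R} :
  0 < a -> 0 < b ->
  edge_ratio alpha a a =
  edge_ratio alpha a b * ((a / b) `^ alpha / (2 / (1 + a / b))).
Proof.
move=> a0 b0; rewrite /edge_ratio.
have -> : a * a = a / b * (a * b) by field; rewrite gt_eqF.
rewrite [in LHS]powRM ?divr_ge0 ?mulr_ge0 ?(ltW a0) ?(ltW b0) //.
rewrite [(a / b) `^ _]gt0_powRD ?divr_gt0 // powRr1 ?divr_ge0 ?ltW //.
by field; rewrite !gt_eqF ?addr_gt0.
Qed.

Lemma edge_ratio_gt0 {R : realType} (alpha : R) {x y : R} :
  0 < x -> 0 < y -> 0 < edge_ratio alpha x y.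
Proof.
by move=> x0 y0; rewrite divr_gt0 ?addr_gt0 // powR_gt0 // mulr_gt0.
Qed.

Lemma corner_threshold {R : realType} {alpha c x p q : R} :
  0 < c < 1 -> 0 < x -> 0 < q -> p = q * (c `^ alpha / x) ->
  (alpha <= logb c x) = (q <= p) /\ (logb c x <= alpha) = (p <= q).
Proof.
move=> c01 x0 q0 ->; rewrite ler_logb // ger_logb // ler_pMr // ger_pMr //.
by rewrite ler_pdivlMr // ler_pdivrMr // !mul1r.
Qed.

(** Since [ln c < 0], this amounts to [4 * c < (1 + c) ^+ 2], that is, [0 < (1 - c) ^+ 2]. *)
Lemma logb_thresholds_lt (R : realType) (c : R) : 0 < c < 1 ->
  logb c ((1 + c) / (2 * c)) < logb c (2 / (1 + c)).
Proof.
move=> /andP[c0 c1]; have lc : ln c < 0 by apply: ln_lt0; rewrite c0.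
have c2 : 0 < 1 + c by rewrite addr_gt0.
have d2 : 0 < 2 * c by rewrite mulr_gt0.
rewrite /logb ltr_nM2r ?invr_lt0 // ltr_ln ?posrE ?divr_gt0 //.
rewrite ltr_pdivrMr // mulrAC ltr_pdivlMr //.
have : 0 < (1 - c) ^+ 2 by rewrite exprn_gt0 // subr_gt0.
lra.
Qed.

(** * Equality classes described by their edges *)

(** Every vertex has a neighbour, and the type of the joining edge determines which degrees it may
    have. *)
Lemma regularP (r : nat) (G : sgraph) : (forall u : G, (0 < deg u)%N) ->
  regular r G <-> (forall u v : G, adj u v -> edge_type r r u v).
Proof.
move=> d0; split=> [reg u v _|edge u]; first by left.
have /card_gt0P[v] := d0 u.
by rewrite inE => /edge[[]|[]].
Qed.

Lemma biregularP (r s : nat) (G : sgraph) : (forall u : G, (0 < deg u)%N) ->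
  biregular r s G <-> (forall u v : G, adj u v -> edge_type r s u v).
Proof.
move=> d0; split=> [[]//|edge]; split=> // u.
have /card_gt0P[v] := d0 u.
by rewrite inE => /edge[[]|[]]; [left|right].
Qed.

Lemma mixedP (r s : nat) (G : sgraph) : (forall u : G, (0 < deg u)%N) ->
  mixed r s G <->
  (forall u v : G, adj u v -> edge_type r r u v \/ edge_type r s u v).
Proof.
move=> d0; split=> [[]//|edge]; split=> // u.
have /card_gt0P[v] := d0 u.
by rewrite inE => /edge[[[]|[]]|[[]|[]]]; [left|left|left|right].
Qed.

Lemma edge_ratio_type {R : realType} (alpha : R) {r s : nat} {G : sgraph}
    {u v : G} :
  edge_type r s u v ->
  edge_ratio alpha (deg u)%:R (deg v)%:R = edge_ratio alpha r%:R s%:R.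
Proof. by case=> -[-> ->] //; rewrite edge_ratioC. Qed.

Lemma edge_typeC (r s : nat) (G : sgraph) (u v : G) :
  edge_type r s u v <-> edge_type s r u v.
Proof. by rewrite /edge_type; tauto. Qed.

(** * From corner values to bounds on the index *)

(** Leaving [K] free serves all regimes at once: in the equality case each edge sits at a corner
    whose value is [K], and the regime decides which corners qualify. *)
Lemma randic_ge_corners (R : realType) (delta Delta : nat) (alpha K : R)
    (G : sgraph) :
  (0 < delta)%N ->
  (forall u : G, (delta <= deg u)%N) -> (forall u : G, (deg u <= Delta)%N) ->
  K <= edge_ratio alpha delta%:R delta%:R ->
  K <= edge_ratio alpha delta%:R Delta%:R ->
  K <= edge_ratio alpha Delta%:R Delta%:R ->
  K * #|{: G}|%:R <= randic alpha G /\
  (randic alpha G = K * #|{: G}|%:R <-> forall u v : G, adj u v ->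
    [\/ edge_type delta delta u v /\ edge_ratio alpha delta%:R delta%:R = K,
        edge_type delta Delta u v /\ edge_ratio alpha delta%:R Delta%:R = K |
        edge_type Delta Delta u v /\ edge_ratio alpha Delta%:R Delta%:R = K]).
Proof.
move=> delta0 dmin dmax Kaa Kab Kbb.
have d0 (u : G) : (0 < deg u)%N by apply: leq_trans (dmin u).
have corners u v := @edge_ratio_ge_corners R alpha K delta%:R Delta%:R
  (@deg G u)%:R (@deg G v)%:R.
have rng (u : G) : delta%:R <= ((deg u)%:R : R) <= Delta%:R.
  by rewrite !ler_nat dmin dmax.
have dR : 0 < delta%:R :> R by rewrite ltr0n.
have leK u v : adj u v -> K <= edge_ratio alpha (@deg G u)%:R (@deg G v)%:R.
  by move=> _; case: (corners u v dR (rng u) (rng v) Kaa Kab Kbb).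
have [leR eqR] := @randic_ge R alpha K G d0 leK.
split=> //; rewrite eqR; split=> edge u v uv; last first.
  by case: (edge u v uv) => -[/edge_ratio_type ->].
have eK := edge u v uv.
have [_ /(_ eK)[]] := corners u v dR (rng u) (rng v) Kaa Kab Kbb.
have natE (m n : nat) : m%:R = n%:R :> R -> m = n.
  by move/eqP; rewrite eqr_nat => /eqP.
move=> [/natE eu|/natE eu] [/natE ev|/natE ev].
- by apply: Or31; rewrite -eK eu ev; split=> //; left.
- by apply: Or32; rewrite -eK eu ev; split=> //; left.
- by apply: Or32; rewrite -eK edge_ratioC eu ev; split=> //; right.
- by apply: Or33; rewrite -eK eu ev; split=> //; left.
Qed.

Theorem theorem3 (R : realType) (delta Delta : nat) (alpha : R) (G : sgraph)
  (delta_gt0 : (0 < delta)%N) (delta_lt_Delta : (delta < Delta)%N)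
  (min_deg : forall u : G, (delta <= deg u)%N)
  (max_deg : forall u : G, (deg u <= Delta)%N) :
  let c : R := delta%:R / Delta%:R in
  let lo : R := logb c ((1 + c) / (2 * c)) in
  let hi : R := logb c (2 / (1 + c)) in
  let n : R := #|{: G}|%:R in
  let bound_Delta : R := Delta%:R `^ (1 + 2 * alpha) / 2 * n in
  let bound_mid : R :=
    (delta%:R * Delta%:R) `^ (1 + alpha) / (delta%:R + Delta%:R) * n in
  let bound_delta : R := delta%:R `^ (1 + 2 * alpha) / 2 * n in
  (* lower bounds, with their equality cases *)
  (alpha <= lo ->
     bound_Delta <= randic alpha G /\
     (regular Delta G -> randic alpha G = bound_Delta)) /\
  (lo <= alpha -> alpha <= hi ->
     bound_mid <= randic alpha G /\
     (biregular delta Delta G -> randic alpha G = bound_mid)) /\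
  (hi <= alpha ->
     bound_delta <= randic alpha G /\
     (regular delta G -> randic alpha G = bound_delta)) /\
  (* no other equality cases away from the boundaries *)
  (alpha < lo -> randic alpha G = bound_Delta -> regular Delta G) /\
  (lo < alpha -> alpha < hi ->
     randic alpha G = bound_mid -> biregular delta Delta G) /\
  (hi < alpha -> randic alpha G = bound_delta -> regular delta G) /\
  (* equality on the boundaries *)
  (alpha = lo ->
     (randic alpha G = bound_Delta <-> mixed Delta delta G) /\
     (randic alpha G = bound_mid <-> mixed Delta delta G)) /\
  (alpha = hi ->
     (randic alpha G = bound_mid <-> mixed delta Delta G) /\
     (randic alpha G = bound_delta <-> mixed delta Delta G)) /\
  (* upper bounds *)
  (alpha < - (1 / 2) ->
     randic alpha G <= bound_delta /\
     (randic alpha G = bound_delta <-> regular delta G)) /\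
  (- (1 / 2) < alpha ->
     randic alpha G <= bound_Delta /\
     (randic alpha G = bound_Delta <-> regular Delta G)).
Proof.
move=> c lo hi n bound_Delta bound_mid bound_delta.
have Delta_gt0 := ltn_trans delta_gt0 delta_lt_Delta.
have a0 : 0 < delta%:R :> R by rewrite ltr0n.
have b0 : 0 < Delta%:R :> R by rewrite ltr0n.
have c01 : 0 < c < 1 by rewrite divr_gt0 //= ltr_pdivrMr // mul1r ltr_nat.
have lo_lt_hi : lo < hi by apply: logb_thresholds_lt.
have deg_gt0 (u : G) : (0 < deg u)%N by apply: leq_trans (min_deg u).
have c0 : 0 < c by case/andP: c01.
have c1_gt0 : 0 < 1 + c by rewrite addr_gt0.
have lo_gt0 : 0 < (1 + c) / (2 * c) by rewrite divr_gt0 // mulr_gt0.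
have hi_gt0 : 0 < 2 / (1 + c) by rewrite divr_gt0.
pose faa := edge_ratio alpha (delta%:R : R) delta%:R.
pose fab := edge_ratio alpha (delta%:R : R) Delta%:R.
pose fbb := edge_ratio alpha (Delta%:R : R) Delta%:R.
(* The position of [alpha] relative to [lo] is the order of [fab] and [fbb]; relative to [hi] it is
   the order of [faa] and [fab]. *)
have [le_lo ge_lo] := corner_threshold c01 lo_gt0 (edge_ratio_gt0 alpha b0 b0)
  (edge_ratio_corner_max alpha a0 b0).
have [le_hi ge_hi] := corner_threshold c01 hi_gt0 (edge_ratio_gt0 alpha a0 b0)
  (edge_ratio_corner_min alpha a0 b0).
rewrite -/lo -/fab -/fbb in le_lo ge_lo; rewrite -/hi -/fab -/faa in le_hi ge_hi.
have -> : bound_Delta = fbb * n by rewrite /fbb edge_ratio_diag.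
have -> : bound_delta = faa * n by rewrite /faa edge_ratio_diag.
have -> : bound_mid = fab * n by [].
have reg r := @regularP r G deg_gt0.
have bireg r s := @biregularP r s G deg_gt0.
have mix r s := @mixedP r s G deg_gt0.
have lower (K : R) := @randic_ge_corners R delta Delta alpha K G
  delta_gt0 min_deg max_deg.
rewrite -/faa -/fab -/fbb in lower.
have gt_lo : (lo < alpha) = (fab < fbb) by rewrite !ltNge le_lo.
have lt_lo : (alpha < lo) = (fbb < fab) by rewrite !ltNge ge_lo.
have gt_hi : (hi < alpha) = (faa < fab) by rewrite !ltNge le_hi.
have lt_hi : (alpha < hi) = (fab < faa) by rewrite !ltNge ge_hi.
(* In each regime [K] is the least corner value. In the two outer regimes the opposite diagonal
   corner is compared through [fab], using [lo < hi]. *)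
split=> [al|].
  have hab : fbb <= fab by rewrite -le_lo.
  have haa : fbb <= faa.
    by apply: le_trans hab _; rewrite -le_hi (le_trans al) // ltW.
  have [le_R eq_R] := lower fbb haa hab (lexx _); split=> // /reg edge.
  by apply/eq_R => u v uv; apply: Or33; split=> //; apply: edge.
split=> [al ah|].
  have hbb : fab <= fbb by rewrite -ge_lo.
  have haa : fab <= faa by rewrite -le_hi.
  have [le_R eq_R] := lower fab haa (lexx _) hbb; split=> // /bireg edge.
  by apply/eq_R => u v uv; apply: Or32; split=> //; apply: edge.
split=> [ah|].
  have hab : faa <= fab by rewrite -ge_hi.
  have hbb : faa <= fbb.
    by apply: le_trans hab _; rewrite -ge_lo (le_trans _ ah) // ltW.
  have [le_R eq_R] := lower faa (lexx _) hab hbb; split=> // /reg edge.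
  by apply/eq_R => u v uv; apply: Or31; split=> //; apply: edge.
(* Off the boundaries the other two corner values strictly exceed [K], which leaves one edge
   type. *)
split=> [al|].
  have hab : fbb < fab by rewrite -lt_lo.
  have haa : fbb < faa.
    by apply: lt_trans hab _; rewrite -lt_hi (lt_trans al).
  have [_ eq_R] := lower fbb (ltW haa) (ltW hab) (lexx _).
  move=> /eq_R edge; apply/reg => u v /edge[[_ e]|[_ e]|[]//].
    by move: haa; rewrite e ltxx.
  by move: hab; rewrite e ltxx.
split=> [al ah|].
  have hbb : fab < fbb by rewrite -gt_lo.
  have haa : fab < faa by rewrite -lt_hi.
  have [_ eq_R] := lower fab (ltW haa) (lexx _) (ltW hbb).
  move=> /eq_R edge; apply/bireg => u v /edge[[_ e]|[]//|[_ e]].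
    by move: haa; rewrite e ltxx.
  by move: hbb; rewrite e ltxx.
split=> [ah|].
  have hab : faa < fab by rewrite -gt_hi.
  have hbb : faa < fbb.
    by apply: lt_trans hab _; rewrite -gt_lo (lt_trans _ ah).
  have [_ eq_R] := lower faa (lexx _) (ltW hab) (ltW hbb).
  move=> /eq_R edge; apply/reg => u v /edge[[]//|[_ e]|[_ e]].
    by move: hab; rewrite e ltxx.
  by move: hbb; rewrite e ltxx.
(* On a boundary two adjacent corners tie and the third is strictly larger, so exactly two edge
   types remain, and two of the bounds coincide. *)
split=> [al|].
  have hab : fab = fbb by apply/le_anti; rewrite -le_lo -ge_lo al lexx.
  have haa : fbb < faa by rewrite -hab -lt_hi al.
  rewrite hab; suff eq_R : randic alpha G = fbb * n <-> mixed Delta delta G.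
    by split.
  have hab' : fbb <= fab by rewrite hab.
  have [_ ->] := lower fbb (ltW haa) hab' (lexx _); split.
    move=> edge; apply/mix => u v /edge[[_ e]|[ty _]|[ty _]].
    - by move: haa; rewrite e ltxx.
    - by right; apply/edge_typeC.
    - by left.
  move=> /mix edge u v /edge[ty|/edge_typeC ty]; first exact: Or33.
  exact: Or32.
split=> [ah|].
  have hab : fab = faa by apply/le_anti; rewrite -le_hi -ge_hi ah lexx.
  have hbb : faa < fbb by rewrite -hab -gt_lo ah.
  rewrite hab; suff eq_R : randic alpha G = faa * n <-> mixed delta Delta G.
    by split.
  have hab' : faa <= fab by rewrite hab.
  have [_ ->] := lower faa (lexx _) hab' (ltW hbb); split.
    move=> edge; apply/mix => u v /edge[[ty _]|[ty _]|[_ e]].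
    - by left.
    - by right.
    - by move: hbb; rewrite e ltxx.
  move=> /mix edge u v /edge[ty|ty]; first exact: Or31.
  exact: Or32.
have natE (k l : nat) : k%:R = l%:R :> R -> k = l.
  by move/eqP; rewrite eqr_nat => /eqP.
(* The maximal edge ratio is attained at a single point, which fixes the degrees of both ends of
   every edge when equality holds. *)
split=> al.
  have degd (u : G) : delta%:R <= (deg u)%:R :> R by rewrite ler_nat.
  have upper (u v : G) := edge_ratio_le_min al a0 (degd u) (degd v).
  have [|le_R eq_R] := @randic_le R alpha faa G deg_gt0.
    by move=> u v _; case: (upper u v).
  split=> //; rewrite eq_R reg; split=> edge u v uv.
    by have [_ /(_ (edge u v uv))[/natE eu /natE ev]] := upper u v; left.
  by rewrite (edge_ratio_type alpha (edge u v uv)).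
have degR (u : G) : 0 < (deg u)%:R :> R by rewrite ltr0n.
have degD (u : G) : (deg u)%:R <= Delta%:R :> R by rewrite ler_nat.
have upper (u v : G) :=
  edge_ratio_le_max al (degR u) (degR v) (degD u) (degD v).
have [|le_R eq_R] := @randic_le R alpha fbb G deg_gt0.
  by move=> u v _; case: (upper u v).
split=> //; rewrite eq_R reg; split=> edge u v uv.
  by have [_ /(_ (edge u v uv))[/natE eu /natE ev]] := upper u v; left.
by rewrite (edge_ratio_type alpha (edge u v uv)).
Qed.
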